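(* Let $g\in R$, $\lambda\in\mathbb K$, $Y=X+g(D)$, $F=-D$, $H=2YD-\lambda$, $E=Y^2D-\lambda Y$. Let $G(D)\in D\,\mathbb K[[D]]$ be the unique formal power series with $G'(D)=g(D)$, and let $U_g=\exp(G(D))$, acting on $\mathcal P=\mathbb K[x]$. Then, as operators on $\mathcal P$, $$Y=U_gXU_g^{-1},\qquad F=U_g(-D)U_g^{-1},$$ and consequently $$H=U_g(2XD-\lambda)U_g^{-1},\qquad E=U_g(X^2D-\lambda X)U_g^{-1}.$$ The polynomials $p_n(x)=U_g\,x^{\underline n}$, $n\ge0$, are monic of degree $n$ and satisfy (with $p_{-1}=0$) $$Dp_n=np_{n-1},\qquad Yp_n=p_{n+1},$$ $$Fp_n=-np_{n-1},\qquad Hp_n=(2n-\lambda)p_n,\qquad Ep_n=(n-\lambda)p_{n+1}.$$ For each $n$, the polynomial $p_n$ is the unique monic degree-$n$ eigenpolynomial of $H$ with eigenvalue $2n-\lambda$. Their exponential generating function is, in $\mathbb K[x][[z]]$, $$\sum_{n=0}^{\infty}p_n(x)\frac{z^n}{n!}=e^{G(z)}(1+z)^x.$$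
   Context: $\mathbb K$ is a field of characteristic zero. $\mathcal A=\mathbb K[x]\langle S,S^{-1}\rangle/(Sx-(x+1)S)$ acts on $\mathcal P=\mathbb K[x]$ by $(Sf)(x)=f(x+1)$ and with $x$ acting by multiplication. Set $D=S-1$, $X=xS^{-1}$, $R=\mathbb K[D,(D+1)^{-1}]=\mathbb K[S,S^{-1}]$; elements of $R$ are regarded as elements of $\mathbb K[[D]]$ by Taylor expansion at $D=0$, and $'$ is the formal derivative in $D$. Since $D$ is locally nilpotent on $\mathcal P$, elements of $\mathbb K[[D]]$ act on $\mathcal P$. Notation: $x^{\underline n}=x(x-1)\cdots(x-n+1)$, $x^{\underline 0}=1$, and $(1+z)^x=\sum_{n\ge0}x^{\underline n}z^n/n!$. *)

(* Defs.v *)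
From HB Require Import structures.
From mathcomp Require Import all_boot all_order all_algebra.
From mathcomp Require Import finmap.

Set Implicit Arguments.
Unset Strict Implicit.
Unset Printing Implicit Defensive.

Import GRing.Theory.
Local Open Scope ring_scope.

(* Formal power series over A, given by their coefficient sequences. *)
Definition fps (A : Type) : Type := nat -> A.

Section FormalPowerSeries.
Variable A : nzRingType.
Implicit Types a b : fps A.

Definition fps_one : fps A := fun n => (n == 0%N)%:R.
Definition fps_mul a b : fps A := fun n => \sum_(i < n.+1) a i * b (n - i)%N.
Definition fps_pow a (k : nat) : fps A := iter k (fps_mul a) fps_one.
Definition fps_deriv a : fps A := fun n => a n.+1 *+ n.+1.

Definition fps_1pD : fps A := fun n => (n < 2)%N%:R.
Definition fps_1pDV : fps A := fun n => (-1) ^+ n.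

Lemma fps_1pDVK n : fps_mul fps_1pD fps_1pDV n = fps_one n.
Proof.
rewrite /fps_mul /fps_1pD /fps_1pDV /fps_one; case: n => [|n].
  by rewrite big_ord_recl big_ord0 /= addr0 mul1r.
rewrite !big_ord_recl big1 => [|i _]; last by rewrite mul0r.
by rewrite /= addr0 !mul1r subn0 subSS subn0 exprS mulN1r addNr.
Qed.

End FormalPowerSeries.

Section Operators.
Variable K : fieldType.
Implicit Types (f : {poly K}) (a : fps K).

(* exp a = \sum_k a ^ k / k!.  Intended for a 0 = 0: then a ^ k has order at
   least k, so only the terms k <= n contribute to the n-th coefficient. *)
Definition fps_exp a : fps K :=
  fun n => \sum_(k < n.+1) fps_pow a k n / k`!%:R.

Definition is_primitive (G a : fps K) : Prop :=
  G 0%N = 0 /\ fps_deriv G =1 a.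

Definition opS f : {poly K} := f \Po ('X + 1).
Definition opSV f : {poly K} := f \Po ('X - 1).
Definition opSz (k : int) : {poly K} -> {poly K} :=
  match k with Posz n => iter n opS | Negz n => iter n.+1 opSV end.
Definition opD f : {poly K} := opS f - f.
Definition opX f : {poly K} := 'X * opSV f.

Lemma opSK : cancel opS opSV.
Proof.
by move=> f; rewrite /opS /opSV -comp_polyA comp_polyD comp_polyX comp_polyC
  subrK comp_polyXr.
Qed.

Lemma opSVK : cancel opSV opS.
Proof.
by move=> f; rewrite /opS /opSV -comp_polyA comp_polyB comp_polyX comp_polyC
  addrK comp_polyXr.
Qed.

Lemma opS_mulX f : opS ('X * f) = ('X + 1) * opS f.
Proof. by rewrite /opS comp_polyM comp_polyX. Qed.

(* A Laurent polynomial g in S stands for \sum_k (g k) S ^ k.  As D = S - 1,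
   this is the ring K[D, (D + 1)^-1]. *)
Definition laurent : Type := {fsfun int -> K with 0}.

Definition laurent_act (g : laurent) f : {poly K} :=
  \sum_(k <- finsupp g) g k *: opSz k f.

Definition taylorS (k : int) : fps K :=
  match k with
  | Posz n => fps_pow (fps_1pD K) n
  | Negz n => fps_pow (fps_1pDV K) n.+1
  end.

(* The expansion at D = 0, that is, the image under S |-> 1 + D. *)
Definition taylor (g : laurent) : fps K :=
  fun n => \sum_(k <- finsupp g) g k * taylorS k n.

(* The action of \sum_n (a n) D ^ n.  Since D lowers degrees, D ^ n f = 0 as
   soon as n >= size f; see fps_act_widen. *)
Definition fps_act a f : {poly K} :=
  \sum_(n < size f) a n *: iter n opD f.

Lemma size_opD f : (size (opD f) <= (size f).-1)%N.
Proof.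
elim/poly_ind: f => [|f c IH]; first by rewrite /opD /opS comp_poly0 subr0 size_poly0.
have -> : opD (f * 'X + c%:P) = opD f * ('X + 1) + f.
  rewrite /opD /opS comp_polyD comp_polyM comp_polyX comp_polyC opprD addrACA.
  by rewrite subrr addr0 mulrBl mulrDr mulr1 mulrDr mulr1 opprD addrA subrK.
have [-> | f0] := eqVneq f 0.
  by rewrite /opD /opS comp_poly0 subr0 mul0r addr0 size_poly0.
have -> : size (f * 'X + c%:P) = (size f).+1.
  by rewrite size_MXaddC (negPf f0).
rewrite (leq_trans (size_polyD _ _)) // geq_max leqnn andbT.
rewrite (leq_trans (size_polyMleq _ _)) // -[X in _ + X]polyC1 size_XaddC addn2 /=.
by apply: leq_trans (_ : ((size f).-1).+1 <= _)%N; rewrite ?ltnS // prednK // size_poly_gt0.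
Qed.

Lemma opD_nilp f n : (size f <= n)%N -> iter n opD f = 0.
Proof.
move=> le_fn; apply/eqP; rewrite -size_poly_leq0.
suff: (size (iter n opD f) <= size f - n)%N by rewrite (eqP le_fn).
elim: n {le_fn} => [|n IH] /=; first by rewrite subn0.
by rewrite (leq_trans (size_opD _)) // subnS -!subn1 leq_sub2r.
Qed.

Lemma fps_act_widen a f N : (size f <= N)%N ->
  fps_act a f = \sum_(n < N) a n *: iter n opD f.
Proof.
move=> le_fN; rewrite /fps_act -!(big_mkord xpredT (fun n => a n *: iter n opD f)).
rewrite (big_cat_nat (leq0n _) le_fN) /=.
rewrite [X in _ = _ + X]big1_seq ?addr0 // => n; rewrite mem_index_iota.
by case/and3P=> _ le_fn _; rewrite opD_nilp // scaler0.
Qed.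

Definition opY (g : laurent) f : {poly K} := opX f + laurent_act g f.
Definition opF f : {poly K} := - opD f.
Definition opH (g : laurent) (lam : K) f : {poly K} :=
  2 *: opY g (opD f) - lam *: f.
Definition opE (g : laurent) (lam : K) f : {poly K} :=
  opY g (opY g (opD f)) - lam *: opY g f.

Definition falling (n : nat) : {poly K} := \prod_(i < n) ('X - i%:R%:P).

Definition one_plus_z_pow_x : fps {poly K} :=
  fun n => (n`!%:R)^-1 *: falling n.

End Operators.

(* The sequence n |-> p (n - 1), with the convention p (-1) = 0. *)
Definition prev_term (V : nmodType) (p : nat -> V) (n : nat) : V :=
  if n is m.+1 then p m else 0.

(* Main.v *)
(** Since [D X = X D + 1], every series satisfies [a(D) X = X a(D) + a'(D)].
    For [a = exp G] with [G' = g] this reads [U X = (X + g(D)) U = Y U], while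
    [U] commutes with [D]; so conjugation by [U] carries the relations of [X]
    and [D] on the falling factorials to those of [Y] and [D] on the [p_n].
    The inverse of [U] is [exp (- G)], because the product of the two
    exponentials has derivative zero.  An eigenpolynomial of [Y D] for the
    eigenvalue [n] of degree less than [n] vanishes: applying [D] lowers both
    the eigenvalue and the degree by one. *)
Require Import Defs.
From HB Require Import structures.
From mathcomp Require Import all_boot all_order all_algebra.
From mathcomp Require Import finmap zify.
From Stdlib Require Import FunctionalExtensionality.

Set Implicit Arguments.
Unset Strict Implicit.
Unset Printing Implicit Defensive.

Import GRing.Theory.
Local Open Scope ring_scope.

(** * Ring laws of power series, obtained from polynomials *)

Section SeriesAlgebra.
Variable R : comNzRingType.
Implicit Types (a b c : fps R) (p q : {poly R}).

(** Coefficient [n] of a product sees only coefficients up to [n], so identities between series can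
    be checked on polynomial truncations. *)
Lemma fps_mul_coef a b p q n :
  (forall i, (i <= n)%N -> a i = p`_i) ->
  (forall i, (i <= n)%N -> b i = q`_i) ->
  fps_mul a b n = (p * q)`_n.
Proof.
move=> ap bq; rewrite coefM; apply: eq_bigr => i _.
by rewrite ap -1?ltnS // bq ?leq_subr.
Qed.

Lemma fps_truncP a N : exists p : {poly R}, forall i, (i <= N)%N -> a i = p`_i.
Proof. by exists (\poly_(j < N.+1) a j) => i le_iN; rewrite coef_poly ltnS le_iN. Qed.

Lemma fps_mulC a b : fps_mul a b = fps_mul b a.
Proof.
apply: functional_extensionality => n.
have [[p aP] [q bP]] := (fps_truncP a n, fps_truncP b n).
by rewrite (fps_mul_coef aP bP) (fps_mul_coef bP aP) mulrC.
Qed.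

Lemma fps_mulA a b c : fps_mul a (fps_mul b c) = fps_mul (fps_mul a b) c.
Proof.
apply: functional_extensionality => n.
have [p aP] := fps_truncP a n; have [q bP] := fps_truncP b n.
have [r cP] := fps_truncP c n.
(* Agreement at every index up to [n], not just at [n], is what lets products be nested. *)
have mulP u v p1 p2 (uP : forall i, (i <= n)%N -> u i = p1`_i)
    (vP : forall i, (i <= n)%N -> v i = p2`_i) i :
    (i <= n)%N -> fps_mul u v i = (p1 * p2)`_i.
  move=> le_in; apply: fps_mul_coef => j le_ji.
    by rewrite uP ?(leq_trans le_ji).
  by rewrite vP ?(leq_trans le_ji).
rewrite (fps_mul_coef aP (mulP _ _ _ _ bP cP)).
by rewrite (fps_mul_coef (mulP _ _ _ _ aP bP) cP) mulrA.
Qed.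

Lemma fps_mulNl a b n : fps_mul (fun i => - a i) b n = - fps_mul a b n.
Proof. by rewrite /fps_mul -sumrN; apply: eq_bigr => i _; rewrite mulNr. Qed.

Lemma fps_derivM a b n :
  fps_deriv (fps_mul a b) n = fps_mul (fps_deriv a) b n + fps_mul a (fps_deriv b) n.
Proof.
(* Truncation is at [n.+1] because the derivative reads one coefficient further. *)
have [[p aP] [q bP]] := (fps_truncP a n.+1, fps_truncP b n.+1).
rewrite /fps_deriv (fps_mul_coef aP bP) -coef_deriv derivM coefD.
congr (_ + _); apply/esym/fps_mul_coef => i le_in;
  by rewrite ?coef_deriv -?(aP, bP) ?ltnS // ltnW.
Qed.

Lemma fps_pow_coef a p k n :
  (forall i, (i <= n)%N -> a i = p`_i) -> fps_pow a k n = (p ^+ k)`_n.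
Proof.
elim: k n => [|k IH] n ap; first by rewrite coef1.
rewrite exprS; apply: fps_mul_coef => // i le_in.
by apply: IH => j le_ji; rewrite ap ?(leq_trans le_ji).
Qed.

Lemma coef_exp_lt p k n : p`_0 = 0 -> (n < k)%N -> (p ^+ k)`_n = 0.
Proof.
move=> p0; elim: k n => // k IH n lt_nk.
rewrite exprS coefM big1 // => i _; case: i => [[|i] /= le_in].
  by rewrite p0 mul0r.
by rewrite IH ?mulr0 //; lia.
Qed.

End SeriesAlgebra.

(** * The exponential of a series and its differential equation *)

Section Exponential.
Variable K : fieldType.
Hypothesis charK0 : [pchar K] =i pred0.
Implicit Types a b G : fps K.

Lemma natf_neq0_pchar0 n : (n%:R == 0 :> K) = (n == 0%N).
Proof. by move/pcharf0P: charK0. Qed.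

(** As [p] has no constant term, [p ^+ k] has order at least [k]. The free bound [M] lets one
    polynomial serve for all small indices. *)
Lemma fps_exp_coef G (p : {poly K}) M n : (n < M)%N -> G 0%N = 0 ->
  (forall i, (i <= n)%N -> G i = p`_i) ->
  fps_exp G n = (\sum_(k < M) (k`!%:R)^-1 *: p ^+ k)`_n.
Proof.
move=> ltnM G0 GP; rewrite coef_sum /fps_exp.
rewrite -(big_mkord xpredT (fun k => ((k`!%:R)^-1 *: p ^+ k)`_n)).
rewrite (big_cat_nat (leq0n _) ltnM) /= big_mkord.
rewrite [X in _ = _ + X]big1_seq ?addr0 => [|k].
  by apply: eq_bigr => k _; rewrite (fps_pow_coef _ GP) coefZ mulrC.
rewrite mem_index_iota => /and3P[_ lt_nk _].
by rewrite coefZ coef_exp_lt ?mulr0 // -GP.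
Qed.

Lemma fps_exp0 G : fps_exp G 0%N = 1.
Proof. by rewrite /fps_exp big_ord1 /= fact0 divr1. Qed.

Lemma fps_exp_deriv G : G 0%N = 0 ->
  fps_deriv (fps_exp G) = fps_mul (fps_deriv G) (fps_exp G).
Proof.
move=> G0; apply: functional_extensionality => n.
have [p GP] := fps_truncP G n.+1.
have expP i : (i <= n.+1)%N ->
    fps_exp G i = (\sum_(k < n.+2) (k`!%:R)^-1 *: p ^+ k)`_i.
  by move=> le_in; apply: fps_exp_coef => // j le_ji; rewrite GP ?(leq_trans le_ji).
have -> : fps_mul (fps_deriv G) (fps_exp G) n =
    (p^`() * \sum_(k < n.+1) (k`!%:R)^-1 *: p ^+ k)`_n.
  apply: fps_mul_coef => i le_in; first by rewrite coef_deriv -GP.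
  by apply: fps_exp_coef => // j le_ji; apply: GP; lia.
(* The constant term drops out, and the others shift by one since [k.+1 / k.+1]! = 1 / k[!]. *)
rewrite /fps_deriv expP // -coef_deriv big_ord_recl derivD derivZ expr0.
rewrite -polyC1 derivC scaler0 add0r linear_sum mulr_sumr; apply: (congr1 (fun q : {poly K} => q`_n)).
apply: eq_bigr => k _ /=; rewrite /bump /= add1n.
rewrite derivZ deriv_exp -scalerAr -scaler_nat scalerA; congr (_ *: _).
rewrite factS natrM invfM mulrAC mulVf ?mul1r //.
by rewrite natf_neq0_pchar0.
Qed.

Lemma fps_deriv_eq0 a : (forall n, fps_deriv a n = 0) -> forall n, a n.+1 = 0.
Proof.
move=> a'0 n; have /eqP := a'0 n.
by rewrite /fps_deriv -mulr_natr mulf_eq0 natf_neq0_pchar0 orbF => /eqP.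
Qed.

Lemma fps_expN G : G 0%N = 0 ->
  fps_mul (fps_exp G) (fps_exp (fun n => - G n)) = @fps_one K.
Proof.
move=> G0; set e := fps_exp G; set e' := fps_exp _.
have NG0 : (fun n => - G n) 0%N = 0 by rewrite /= G0 oppr0.
apply: functional_extensionality => -[|n].
  by rewrite /fps_mul big_ord1 /e /e' !fps_exp0 mulr1.
rewrite [RHS]/fps_one; apply: fps_deriv_eq0 => {}n.
have NG' : fps_deriv (fun n => - G n) = (fun n => - fps_deriv G n).
  by apply: functional_extensionality => i; rewrite /fps_deriv mulNrn.
(* The derivative of [e e'] is [G' e e' - e G' e'], which cancels by commutativity. *)
rewrite fps_derivM !fps_exp_deriv // NG' -/e -/e'.
rewrite fps_mulA (fps_mulC e) -fps_mulA fps_mulNl -/e fps_mulA.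
by rewrite -fps_mulA subrr.
Qed.

Lemma primitive_exists_unique a : exists! G : fps K, is_primitive G a.
Proof.
exists (fun n => if n is m.+1 then a m / n%:R else 0); split.
  split=> // n; rewrite /fps_deriv /= -[(_ / _) *+ _]mulr_natr divfK //.
  by rewrite natf_neq0_pchar0.
move=> G [G0 G'a]; apply: functional_extensionality => -[//|n].
by rewrite -G'a /fps_deriv -[G _ *+ _]mulr_natr mulfK // natf_neq0_pchar0.
Qed.

End Exponential.

Lemma size_monic_sub_leq (R : nzRingType) (p q : {poly R}) n :
  p \is monic -> q \is monic -> size p = n.+1 -> size q = n.+1 ->
  (size (p - q)%R <= n)%N.
Proof.
move=> /monicP p1 /monicP q1 sp sq; apply/leq_sizeP => j.
rewrite leq_eqVlt coefB => /predU1P[<-|lt_nj].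
  by move: p1 q1; rewrite !lead_coefE sp sq /= => -> ->; rewrite subrr.
by rewrite !nth_default ?sp ?sq ?subrr.
Qed.

(** * The operators on polynomials and the action of series in [D] *)

Section DifferenceOperators.
Variable K : fieldType.
Implicit Types (f : {poly K}) (a b : fps K).

Fact opS_is_linear : linear (@opS K).
Proof. by move=> c f h; rewrite /opS linearP. Qed.
HB.instance Definition _ :=
  GRing.isLinear.Build K {poly K} {poly K} _ (@opS K) opS_is_linear.

Fact opD_is_linear : linear (@opD K).
Proof. by move=> c f h; rewrite /opD linearP /= scalerBr opprD addrACA. Qed.
HB.instance Definition _ :=
  GRing.isLinear.Build K {poly K} {poly K} _ (@opD K) opD_is_linear.

Fact opX_is_linear : linear (@opX K).
Proof. by move=> c f h; rewrite /opX /opSV linearP /= mulrDr scalerAr. Qed.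
HB.instance Definition _ :=
  GRing.isLinear.Build K {poly K} {poly K} _ (@opX K) opX_is_linear.

Fact iter_opD_is_linear n : linear (iter n (@opD K)).
Proof. by move=> c f h; elim: n => //= n ->; rewrite linearP. Qed.
HB.instance Definition _ n :=
  GRing.isLinear.Build K {poly K} {poly K} _ (iter n (@opD K))
    (iter_opD_is_linear n).

(** The range of summation depends on the argument, so all three sums are first brought to the
    common length [N]. *)
Fact fps_act_is_linear a : linear (fps_act a).
Proof.
move=> c f h; pose N := maxn (size f) (size h).
have leN (q : {poly K}) : (size q <= N)%N -> fps_act a q = \sum_(n < N) a n *: iter n (@opD K) q.
  exact: fps_act_widen.
rewrite !leN ?leq_maxl ?leq_maxr //; last first.
  rewrite (leq_trans (size_polyD _ _)) // geq_max leq_maxr andbT.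
  by rewrite (leq_trans (size_scale_leq _ _)) ?leq_maxl.
rewrite scaler_sumr -big_split; apply: eq_bigr => i _ /=.
by rewrite linearP scalerDr !scalerA mulrC.
Qed.
HB.instance Definition _ a :=
  GRing.isLinear.Build K {poly K} {poly K} _ (fps_act a) (fps_act_is_linear a).

(** The Heisenberg relation: [S] turns multiplication by [x] into multiplication by [x + 1], which
    leaves the extra [f]. *)
Lemma opD_opX f : opD (opX f) = opX (opD f) + f.
Proof.
rewrite {1}/opD /opX opS_mulX opSVK [opSV (opD f)]linearB /= -/(opSV _).
by rewrite -/(opSV f) opSK mulrBr mulrDl mul1r addrAC.
Qed.

Lemma iter_opD_opX n f :
  iter n (@opD K) (opX f) = opX (iter n (@opD K) f) + iter n.-1 (@opD K) f *+ n.
Proof.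
elim: n => [|n IH]; first by rewrite addr0.
rewrite iterS IH raddfD /= opD_opX -addrA; congr (_ + _).
rewrite raddfMn /= mulrS; by case: n {IH} => [|n].
Qed.

Lemma size_iter_opD n f : (size (iter n (@opD K) f) <= size f - n)%N.
Proof.
elim: n => [|n IH] /=; first by rewrite subn0.
by rewrite (leq_trans (size_opD _)) // subnS -!subn1 leq_sub2r.
Qed.

Lemma size_opX f : (size (opX f) <= (size f).+1)%N.
Proof.
rewrite /opX (leq_trans (size_polyMleq _ _)) // size_polyX /=.
by rewrite /opSV -polyC1 size_comp_poly2 ?size_XsubC.
Qed.

Lemma fps_act_opX a f :
  fps_act a (opX f) = opX (fps_act a f) + fps_act (fps_deriv a) f.
Proof.
(* Both sums get length [(size f).+1]; in the derivative part the term of index 0 vanishes, leaving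
   exactly [size f] terms. *)
rewrite (fps_act_widen _ (size_opX f)) (fps_act_widen a (leqnSn _)).
rewrite linear_sum /=.
under eq_bigr do rewrite iter_opD_opX scalerDr.
rewrite big_split /=; congr (_ + _).
  by apply: eq_bigr => i _; rewrite linearZ.
rewrite big_ord_recl mulr0n scaler0 add0r; apply: eq_bigr => i _.
by rewrite /fps_deriv /= /bump /= add1n -scalerMnr -scalerMnl.
Qed.

Lemma fps_act1 f : fps_act (@fps_one K) f = f.
Proof.
rewrite (fps_act_widen _ (leqnSn _)) big_ord_recl big1 ?addr0 ?scale1r // => i _.
by rewrite /fps_one /= scale0r.
Qed.

Lemma fps_act_opD a f : fps_act a (opD f) = opD (fps_act a f).
Proof.
rewrite (fps_act_widen a (_ : (size (opD f) <= size f)%N)) /fps_act; last first.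
  by rewrite (leq_trans (size_opD _)) ?leq_pred.
rewrite linear_sum; apply: eq_bigr => i _ /=.
by rewrite linearZ -iterSr.
Qed.

Lemma fps_act_iter_opD a n f :
  fps_act a (iter n (@opD K) f) = iter n (@opD K) (fps_act a f).
Proof. by elim: n => //= n IH; rewrite fps_act_opD IH. Qed.

Lemma size_fps_act_leq a f : (size (fps_act a f) <= size f)%N.
Proof.
apply: (leq_trans (size_sum _ _ _)); apply/bigmax_leqP => i _.
rewrite (leq_trans (size_scale_leq _ _)) // (leq_trans (size_iter_opD i f)) //.
exact: leq_subr.
Qed.

Lemma fps_actM a b f : fps_act (fps_mul a b) f = fps_act a (fps_act b f).
Proof.
rewrite (fps_act_widen a (size_fps_act_leq b f)) /fps_act -/(fps_act b f).
(* The double sum over [i <= n] is exchanged and reindexed by [j = n - i]; then [j < size f - i],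
   the range on which [D ^ j] can act nontrivially on [D ^ i f]. *)
under eq_bigr => n _ do rewrite /fps_mul scaler_suml
  (big_ord_widen _ (fun i => (a i * b (n - i)%N) *: iter n (@opD K) f) (ltn_ord n)).
rewrite (exchange_big_dep xpredT) //=; apply: eq_bigr => i _.
rewrite -fps_act_iter_opD (fps_act_widen b (size_iter_opD i f)) scaler_sumr.
rewrite -(big_geq_mkord _ _ xpredT (fun n => (a i * b (n - i)%N) *: iter n (@opD K) f)).
rewrite -[X in \sum_(X <= _ < _) _]add0n big_addn big_mkord; apply: eq_bigr => j _.
by rewrite addnK iterD scalerA.
Qed.

Lemma fps_act_1pD f : fps_act (fps_1pD K) f = opS f.
Proof.
(* Two extra terms guarantee that the indices 0 and 1 occur even for [f = 0]. *)
rewrite (fps_act_widen _ (leqW (leqnSn _))) !big_ord_recl big1 => [|i _].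
  by rewrite addr0 !scale1r /= /opD addrC subrK.
by rewrite /fps_1pD /= scale0r.
Qed.

Lemma fps_act_1pDV f : fps_act (fps_1pDV K) f = opSV f.
Proof.
apply: (can_inj (@opSK K)); rewrite opSVK -fps_act_1pD -fps_actM.
by rewrite (functional_extensionality _ _ (@fps_1pDVK K)) fps_act1.
Qed.

Lemma fps_act_pow a k f : fps_act (fps_pow a k) f = iter k (fps_act a) f.
Proof. by elim: k => [|k IH]; rewrite ?fps_act1 // [LHS]fps_actM IH. Qed.

Lemma fps_act_taylorS k f : fps_act (taylorS K k) f = opSz k f.
Proof.
case: k => n; rewrite fps_act_pow; apply: eq_iter.
  exact: fps_act_1pD.
exact: fps_act_1pDV.
Qed.

(** This turns [g(D)] in [opY] into a series, so that it commutes with [D] and can be compared with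
    [G']. *)
Lemma fps_act_taylor (g : laurent K) f : fps_act (taylor g) f = laurent_act g f.
Proof.
rewrite /fps_act /laurent_act.
under eq_bigr do rewrite /taylor scaler_suml.
rewrite exchange_big; apply: eq_bigr => k _ /=.
rewrite -fps_act_taylorS /fps_act scaler_sumr.
by apply: eq_bigr => i _; rewrite scalerA.
Qed.

(** Every term beyond the constant one lowers the degree, so such a series acts unitriangularly. *)
Lemma size_fps_act_sub a f : a 0%N = 1 -> f != 0 ->
  (size (fps_act a f - f)%R < size f)%N.
Proof.
move=> a0 f0; have : (0 < size f)%N by rewrite size_poly_gt0.
rewrite /fps_act; case E: (size f) => [//|N] _.
rewrite big_ord_recl a0 scale1r /= addrAC subrr add0r ltnS.
apply: (leq_trans (size_sum _ _ _)); apply/bigmax_leqP => i _.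
rewrite (leq_trans (size_scale_leq _ _)) // (leq_trans (size_iter_opD i.+1 f)) //.
by rewrite E subSS leq_subr.
Qed.

Lemma fps_act_monic a f : a 0%N = 1 -> f \is monic ->
  fps_act a f \is monic /\ size (fps_act a f) = size f.
Proof.
move=> a0 mon_f; have := size_fps_act_sub a0 (monic_neq0 mon_f).
set d := _ - f => lt_df.
have -> : fps_act a f = f + d by rewrite addrC subrK.
by rewrite size_polyDl // monicE lead_coefDl // -monicE.
Qed.

(** * Falling factorials under [X] and [D] *)

Lemma falling0 : falling K 0 = 1.
Proof. by rewrite /falling big_ord0. Qed.

Lemma falling_monic n : falling K n \is monic.
Proof. exact: monic_prod_XsubC. Qed.

Lemma size_falling n : size (falling K n) = n.+1.
Proof. by rewrite size_prod_XsubC /index_enum -enumT size_enum_ord. Qed.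

Lemma opX_falling n : opX (falling K n) = falling K n.+1.
Proof.
rewrite /opX /opSV /falling big_ord_recl subr0 rmorph_prod /=.
congr (_ * _); apply: eq_bigr => i _.
rewrite comp_polyB comp_polyX comp_polyC /= /bump /= -addrA -opprD.
by rewrite -polyC1 -polyCD nat1r.
Qed.

(** Falling factorials are the powers of [X] applied to 1, and [D 1 = 0]; by the Heisenberg relation
    [D] differentiates in [X]. *)
Lemma opD_falling n : opD (falling K n) = n%:R *: prev_term (falling K) n.
Proof.
elim: n => [|n IH].
  by rewrite falling0 /opD /opS -polyC1 comp_polyC subrr scale0r.
rewrite -opX_falling opD_opX IH linearZ /= -natr1 scalerDl scale1r.
congr (_ + _); case: n {IH} => [|n]; first by rewrite !scale0r.
by rewrite /= opX_falling.
Qed.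

Lemma iter_opD_falling i n : (i <= n)%N ->
  iter i (@opD K) (falling K n) = (n ^_ i)%:R *: falling K (n - i).
Proof.
elim: i => [|i IH] lt_in; first by rewrite subn0 scale1r.
rewrite iterS (IH (ltnW lt_in)) linearZ /= opD_falling scalerA -natrM -ffactnSr.
by rewrite -(subnSK lt_in).
Qed.

(** * The operator [Y] and the eigenvectors of [Y D] *)

Lemma opYE (g : laurent K) f : opY g f = opX f + fps_act (taylor g) f.
Proof. by rewrite fps_act_taylor. Qed.

Fact opY_is_linear (g : laurent K) : linear (opY g).
Proof. by move=> c f h; rewrite !opYE !linearP scalerDr addrACA. Qed.
HB.instance Definition _ (g : laurent K) :=
  GRing.isLinear.Build K {poly K} {poly K} _ (opY g) (opY_is_linear g).

Lemma opD_opY (g : laurent K) f : opD (opY g f) = opY g (opD f) + f.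
Proof. by rewrite !opYE linearD /= opD_opX fps_act_opD addrAC. Qed.

Lemma opY_opD_eigen_eq0 (g : laurent K) n f : [pchar K] =i pred0 ->
  (size f <= n)%N -> opY g (opD f) = n%:R *: f -> f = 0.
Proof.
move=> charK0; elim: n f => [|n IH] f.
  by rewrite leqn0 size_poly_eq0 => /eqP.
move=> le_fn YDf; have Df0 : opD f = 0.
  (* Applying [D] to the eigenvalue equation gives [Y D (D f) + D f = (n + 1) D f], so [D f] has
     eigenvalue [n]. *)
  apply: IH; first by rewrite (leq_trans (size_opD _)) // -subn1 leq_subLR.
  have := congr1 (@opD K) YDf; rewrite opD_opY linearZ /= -natr1 scalerDl scale1r.
  exact: addIr.
move/esym/eqP: YDf; rewrite Df0 linear0 scaler_eq0 natf_neq0_pchar0 //.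
by move/eqP.
Qed.

End DifferenceOperators.

Theorem theorem4p1 (K : fieldType) (charK0 : [pchar K] =i pred0)
    (g : laurent K) (lam : K) :
  (exists! G : fps K, is_primitive G (taylor g)) /\
  forall G : fps K, is_primitive G (taylor g) ->
  let U := fps_act (fps_exp G) in
  let D := @opD K in
  let X := @opX K in
  let Y := opY g in
  let F := @opF K in
  let H := opH g lam in
  let E := opE g lam in
  let p := fun n : nat => U (falling K n) in
  [/\ exists Uinv : {poly K} -> {poly K},
        [/\ cancel U Uinv, cancel Uinv U &
        [/\ forall f, Y f = U (X (Uinv f)),
            forall f, F f = U (- D (Uinv f)),
            forall f, H f = U (2 *: X (D (Uinv f)) - lam *: Uinv f) &
            forall f, E f = U (X (X (D (Uinv f))) - lam *: X (Uinv f))]],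
      forall n, p n \is monic /\ size (p n) = n.+1,
      forall n,
        [/\ D (p n) = n%:R *: prev_term p n,
            Y (p n) = p n.+1,
            F (p n) = - (n%:R *: prev_term p n),
            H (p n) = (2 * n%:R - lam) *: p n &
            E (p n) = (n%:R - lam) *: p n.+1],
      forall n,
        unique (fun q : {poly K} =>
          [/\ q \is monic, size q = n.+1 & H q = (2 * n%:R - lam) *: q]) (p n) &
      (fun n => (n`!%:R)^-1 *: p n)
        =1 fps_mul (fun n => (fps_exp G n)%:P) (one_plus_z_pow_x K)].
Proof.
split=> [|G [G0 G'g]]; first exact: primitive_exists_unique.
move=> U D X Y F H E p.
have YU f : Y (U f) = U (X f).
  rewrite /U fps_act_opX fps_exp_deriv // fps_actM /Y opYE.
  by rewrite (functional_extensionality _ _ G'g).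
have DU f : D (U f) = U (D f) by rewrite /U fps_act_opD.
pose Uinv := fps_act (fps_exp (fun n => - G n)).
have UinvK : cancel Uinv U by move=> f; rewrite /U -fps_actM fps_expN // fps_act1.
have UK : cancel U Uinv.
  by move=> f; rewrite /Uinv -fps_actM fps_mulC fps_expN // fps_act1.
have p_monic n : p n \is monic /\ size (p n) = n.+1.
  rewrite -(size_falling K n).
  exact: fps_act_monic (fps_exp0 G) (falling_monic K n).
have Dp n : D (p n) = n%:R *: prev_term p n.
  rewrite /p DU /D opD_falling /U linearZ /=.
  by case: n => [|n] //=; rewrite linear0.
have Yp n : Y (p n) = p n.+1 by rewrite /p YU /X opX_falling.
have YDp n : Y (D (p n)) = n%:R *: p n.
  (* For [n = 0] the factor [n] makes both sides zero. *)
  by rewrite Dp /Y linearZ -/Y; case: n => [|n] /=; rewrite ?scale0r // [opY _ _]Yp.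
have Hp n : H (p n) = (2 * n%:R - lam) *: p n.
  by rewrite /H /opH [opY _ _]YDp scalerA scalerBl.
split=> //.
(* In each conjugate [U] is pushed inward by [YU] and [DU] until it meets [Uinv]. *)
- exists Uinv; split=> //; split=> f.
  + by rewrite -YU UinvK.
  + by rewrite /U linearN /= -/U -DU UinvK.
  + rewrite /U linearB !linearZ /= -/U -YU -DU UinvK.
    by rewrite scalerN.
  + rewrite /U linearB linearZ /= -/U -!YU -DU UinvK.
    by rewrite /E /opE.
- move=> n; split=> //; first by rewrite /F /opF [opD _]Dp.
  rewrite /E /opE [opY g (opD _)]YDp linearZ /= [opY _ _]Yp.
  by rewrite scalerBl.
- move=> n; split=> [|q [q_monic size_q Hq]]; first by have [] := p_monic n.
  have [pn_monic size_pn] := p_monic n.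
  have YDq : Y (D q) = n%:R *: q.
    (* Adding [lam] and cancelling 2 reduces the equation for [H] to one for [Y D]. *)
    apply: (scalerI (a := 2)); first by rewrite natf_neq0_pchar0.
    by move: Hq; rewrite /H /opH scalerBl -scalerA => /addIr.
  (* The leading terms of the two monic polynomials cancel, so their difference has degree below its
     eigenvalue [n]. *)
  apply/eqP; rewrite -subr_eq0; apply/eqP.
  apply: (@opY_opD_eigen_eq0 _ g n) => //; first exact: size_monic_sub_leq.
  by rewrite [opD _]linearB linearB /= [opY _ _]YDp [opY _ _]YDq -scalerBr.
(* As [falling K n] has size [n.+1], the action is a sum over [i <= n], matched termwise with the
   Cauchy product through [n ^_ i / n]! = 1 / (n - i)[!]. *)
- move=> n; rewrite /p /U /fps_act size_falling /fps_mul scaler_sumr.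
  apply: eq_bigr => i _; have le_in : (i <= n)%N by rewrite -ltnS.
  rewrite iter_opD_falling // mul_polyC /one_plus_z_pow_x !scalerA.
  congr (_ *: _); rewrite -mulrA mulrCA -(ffact_fact le_in) natrM invfM.
  by rewrite mulrAC mulVf ?mul1r // natf_neq0_pchar0 // -lt0n ffact_gt0.
Qed.
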